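(* Let $d \geq 1$ and let $\{X_i\}_{i=1}^{\infty}$ be an evenly distributed family of finite point sets in $B^d \subset \mathbb{R}^d$. Then $L(X_i) \geq \Omega(|X_i|^{1/d})$ as $i\to\infty$.
   Context: $B^d$ denotes the closed Euclidean unit ball in $\mathbb{R}^d$ centered at the origin. For a set $A \subset \mathbb{R}^d$ (with at least two points), $\mu(A)$ denotes the minimum Euclidean distance between distinct points of $A$. Layer number: for a finite set $X \subset \mathbb{R}^d$, let $V(X)$ be the set of vertices (extreme points) of the convex hull $\mathrm{conv}\, X$. The peeling process starts with $X$ and in each step deletes from the current set all vertices of its convex hull, i.e. replaces the current set $Y$ by $Y \setminus V(Y)$, until the empty set is reached. The layer number $L(X)$ is the number of steps required to reach the empty set. Evenly distributed family: a family of finite sets $X_1, X_2, X_3, \dots \subset B^d$ is evenly distributed if $|X_i| \to \infty$ and $\mu(X_i) = \Theta(|X_i|^{-1/d})$ as $i\to\infty$, where the implied constants in $\Theta$ may depend on $d$ and on the family. The implied constant in the conclusion may depend on $d$ and on the constants in the asymptotic bound $\mu(X_i) = \Theta(|X_i|^{-1/d})$. *)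

(* Defs.v *)
From HB Require Import structures.
From mathcomp Require Import all_boot all_order all_algebra finmap.
From mathcomp Require Import all_classical all_reals all_analysis.
From mathcomp Require unstable.
From mathcomp Require Import ring lra.

Set Implicit Arguments.
Unset Strict Implicit.
Unset Printing Implicit Defensive.

Import Order.TTheory GRing.Theory Num.Theory.
Import numFieldNormedType.Exports.

Local Open Scope classical_set_scope.
Local Open Scope ring_scope.
Local Open Scope convex_scope.

Section Defs.
Variables (R : realType) (d : nat).

(* The library norm `|x| on 'rV[R]_d is the sup norm, hence this definition. *)
Definition enorm (x : 'rV[R]_d) : R := Num.sqrt (\sum_(j < d) x 0 j ^+ 2).

Definition unit_ball : set 'rV[R]_d := [set x | enorm x <= 1].

(* If X has at least two points, the set below is finite and nonempty, so its
   infimum is a minimum. *)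
Definition min_dist (X : {fset 'rV[R]_d}) : R :=
  inf [set r | exists x y : 'rV[R]_d,
    [/\ x \in X, y \in X, x != y & r = enorm (x - y)]].

Definition convex_hull (A : set 'rV[R]_d) : set 'rV[R]_d :=
  smallest (@convex_set R 'rV[R]_d) A.

Definition extreme_points (C : set 'rV[R]_d) : set 'rV[R]_d :=
  [set x | C x /\ forall (y z : convex_lmodType 'rV[R]_d) (t : {i01 R}),
     C y -> C z -> 0 < t%:num -> t%:num < 1 -> x = y <| t |> z ->
     y = x /\ z = x].

Definition hull_vertices (X : {fset 'rV[R]_d}) : set 'rV[R]_d :=
  extreme_points (convex_hull [set` X]).

Definition peel (X : {fset 'rV[R]_d}) : {fset 'rV[R]_d} :=
  [fset x in X | ~~ `[< hull_vertices X x >]]%fset.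

Let sqn (x : 'rV[R]_d) : R := \sum_(j < d) x 0 j ^+ 2.

Let sqn_conv (y z : convex_lmodType 'rV[R]_d) (t : {i01 R}) :
  sqn (y <| t |> z) = t%:num * sqn y + (1 - t%:num) * sqn z
     - t%:num * (1 - t%:num) * sqn ((y : 'rV[R]_d) - z).
Proof.
rewrite /sqn !mulr_sumr -big_split/= -sumrB; apply: eq_bigr => j _.
by rewrite !mxE /unstable.onem; ring.
Qed.

Let sqn_ge0 x : 0 <= sqn x.
Proof. by apply: sumr_ge0 => j _; exact: sqr_ge0. Qed.

Let sqn_eq0 x : sqn x = 0 -> x = 0.
Proof.
move=> /eqP; rewrite psumr_eq0 => [/allP x0|j _]; last exact: sqr_ge0.
apply/rowP => j; rewrite mxE; apply/eqP; rewrite -sqrf_eq0.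
exact: (x0 j (mem_index_enum j)).
Qed.

(* A point of X farthest from the origin is a vertex of the hull of X. *)
Lemma hull_vertices_neq0 (X : {fset 'rV[R]_d}) : X != fset0 ->
  exists2 x, x \in X & hull_vertices X x.
Proof.
move=> /fset0Pn[x0 x0X].
have [p _ pmax] := @Order.TotalTheory.arg_maxP _ _ X [` x0X]%fset predT
  (fun u => sqn (val u)) isT.
have pX : val p \in X by exact: valP.
have hb : convex_hull [set` X] `<=` [set x | sqn x <= sqn (val p)].
  apply: smallest_sub => [y z t|y /= yX]; last exact: (pmax [` yX]%fset isT).
  rewrite !inE /= => yp zp; rewrite sqn_conv.
  have t0 : 0 <= t%:num by [].
  have t1 : t%:num <= 1 by [].
  have := mulr_ge0 (mulr_ge0 t0 (_ : 0 <= 1 - t%:num)) (sqn_ge0 ((y : 'rV[R]_d) - z)).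
  rewrite subr_ge0 => /(_ t1).
  have : 0 <= t%:num * (sqn (val p) - sqn y) by rewrite mulr_ge0// subr_ge0.
  have : 0 <= (1 - t%:num) * (sqn (val p) - sqn z).
    by rewrite mulr_ge0// subr_ge0.
  by lra.
exists (val p) => //; split; first exact: sub_gen_smallest.
move=> y z t /hb /= yp /hb /= zp t0 t1 e.
have yz : (y : 'rV[R]_d) - z = 0.
  apply: sqn_eq0; apply/eqP; rewrite eq_le sqn_ge0 andbT.
  have tt : 0 < t%:num * (1 - t%:num) by rewrite mulr_gt0// subr_gt0.
  rewrite -(pmulr_rle0 _ tt).
  have := sqn_conv y z t; rewrite -e.
  have : 0 <= t%:num * (sqn (val p) - sqn y) by rewrite mulr_ge0// subr_ge0.
  have : 0 <= (1 - t%:num) * (sqn (val p) - sqn z).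
    by rewrite mulr_ge0// subr_ge0// ltW.
  by lra.
have {}yz : y = z by apply/eqP; rewrite -subr_eq0; apply/eqP.
by rewrite e yz convmm.
Qed.

Lemma peel_ends (X : {fset 'rV[R]_d}) :
  exists k, iter k peel X == fset0.
Proof.
have [n] := ubnP #|` X|; elim: n X => // n IH X Xn.
have [->|X0] := eqVneq X fset0; first by exists 0%N.
have [x xX vx] := hull_vertices_neq0 X0.
have [|k kP] := IH (peel X); last by exists k.+1; rewrite iterSr.
rewrite -ltnS; apply: leq_trans Xn; rewrite ltnS.
apply: fproper_ltn_card; rewrite fproperE; apply/andP; split.
  by apply/fsubsetP => y; rewrite !inE => /andP[].
apply/fsubsetPn; exists x => //.
by rewrite !inE xX/= negbK; apply/asboolP.
Qed.

Definition layer_number (X : {fset 'rV[R]_d}) : nat := ex_minn (peel_ends X).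

(* The constants a and b in min_dist (X i) = Theta(|X i|^(-1/d)) are explicit
   because the constant in a bound on the layer numbers may depend on them. *)
Definition evenly_distributed (a b : R) (X : nat -> {fset 'rV[R]_d}) : Prop :=
  [/\ forall i, [set` X i] `<=` unit_ball,
      #|` X i| @[i --> \oo] --> \oo &
      \forall i \near \oo,
        a * #|` X i|%:R `^ (- d%:R^-1) <= min_dist (X i) /\
        min_dist (X i) <= b * #|` X i|%:R `^ (- d%:R^-1)].

End Defs.

(* Main.v *)
(** If x is a vertex of conv Y, the points z - x with z in conv Y \ {x} span a
    convex cone missing 0, so Gordan's alternative gives u with <u, y - x> > 0
    for all y in Y \ {x}.  Sort the vertices by the coordinate j where |u_j| is
    maximal and by the sign of u_j: within one of these 2d classes, x_j is a
    1-Lipschitz function (for the l1 norm) of the other d - 1 coordinates.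
    Hence delta-separated vertices in the unit ball project to points of
    [-1, 1]^(d-1) lying in distinct cells of a grid of mesh of order delta, and
    every layer has O(delta^(1-d)) points.  With delta of order n^(-1/d) a layer
    has O(n^((d-1)/d)) points, so there are at least of order n^(1/d) layers. *)
Require Import Defs.
From mathcomp Require Import all_boot all_order all_algebra finmap.
From mathcomp Require Import all_classical all_reals all_analysis.
From mathcomp Require Import ring lra.

Import Order.TTheory GRing.Theory Num.Theory.
Import numFieldNormedType.Exports.

Local Open Scope classical_set_scope.
Local Open Scope ring_scope.

(** * Dot product and Gordan's alternative *)

Section Gordan.
Context {R : realType} {d : nat}.
Implicit Types u v w : 'rV[R]_d.

Definition dot u v : R := \sum_(j < d) u 0 j * v 0 j.

Lemma dotDl u v w : dot (u + v) w = dot u w + dot v w.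
Proof.
by rewrite /dot -big_split; apply: eq_bigr => j _; rewrite /= mxE mulrDl.
Qed.

Lemma dotZl c u v : dot (c *: u) v = c * dot u v.
Proof.
by rewrite /dot mulr_sumr; apply: eq_bigr => j _; rewrite mxE mulrA.
Qed.

Lemma dotC u v : dot u v = dot v u.
Proof. by apply: eq_bigr => j _; rewrite mulrC. Qed.

Lemma dotDr u v w : dot u (v + w) = dot u v + dot u w.
Proof. by rewrite !(dotC u) dotDl. Qed.

Lemma dotZr c u v : dot u (c *: v) = c * dot u v.
Proof. by rewrite !(dotC u) dotZl. Qed.

Lemma dot_gt0 v : v != 0 -> 0 < dot v v.
Proof.
move=> v0; rewrite lt_neqAle sumr_ge0 ?andbT; last first.
  by move=> j _; rewrite -expr2 sqr_ge0.
apply: contraNN v0; rewrite eq_sym psumr_eq0 => [/allP v0|j _]; last first.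
  by rewrite -expr2 sqr_ge0.
apply/eqP/rowP => j; rewrite mxE; apply/eqP; rewrite -sqrf_eq0 expr2.
exact: (v0 j (mem_index_enum j)).
Qed.

(** Provides the perturbations in [gordan]: finitely many strict inequalities survive a small enough
    change. *)
Lemma small_multiple {T : eqType} (s : seq T) (f g : T -> R) :
  (forall x, x \in s -> 0 < f x) ->
  exists2 e, 0 < e & forall x, x \in s -> e * `|g x| < f x.
Proof.
elim: s => [_|m s IH fs]; first by exists 1.
have [x xs|e e0 es] := IH; first by apply: fs; rewrite inE xs orbT.
have fm : 0 < f m by apply: fs; rewrite inE eqxx.
have gm : 0 < `|g m| + 1 by rewrite ltr_wpDl.
exists (Num.min e (f m / (`|g m| + 1))).
  by rewrite lt_min e0 divr_gt0.
move=> x; rewrite inE => /orP[/eqP ->|xs]; last first.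
  by apply: le_lt_trans (es x xs); rewrite ler_wpM2r// ge_min lexx.
apply: (@le_lt_trans _ _ (f m / (`|g m| + 1) * `|g m|)).
  by rewrite ler_wpM2r// ge_min lexx orbT.
by rewrite mulrAC ltr_pdivrMr// ltr_pM2l// ltrDl.
Qed.

(* P plays the part of a convex cone without its apex. *)
Lemma gordan (P : 'rV[R]_d -> Prop) (s : seq 'rV[R]_d) :
  (forall v w, P v -> P w -> P (v + w)) ->
  (forall c v, 0 < c -> P v -> P (c *: v)) ->
  ~ P 0 ->
  (forall v, v \in s -> P v) ->
  exists u, forall v, v \in s -> 0 < dot u v.
Proof.
move=> PD PZ P0; move: {2}(size s) (erefl (size s)) => n.
elim: n s => [|n IH] [|m s]//=; first by exists 0.
move=> [sn] Ps.
have Pm : P m by apply: Ps; rewrite inE eqxx.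
have {}Ps v : v \in s -> P v by move=> vs; apply: Ps; rewrite inE vs orbT.
have m0 : m != 0 by apply/eqP => m0; apply: P0; rewrite -m0.
have [u us] := IH s sn Ps.
have [um|um|um] := ltrgtP 0 (dot u m).
- by exists u => v; rewrite inE => /orP[/eqP ->//|/us].
(* [w v] is orthogonal to [u] and stays in [P], as both coefficients are positive for [v] in [s]. *)
- pose w v := - dot u m *: v + dot u v *: m.
  have [u' u's] : exists u', forall v, v \in map w s -> 0 < dot u' v.
    apply: IH; first by rewrite size_map.
    move=> _ /mapP[v vs ->]; apply: PD; apply: PZ => //; last exact: us.
      by rewrite oppr_gt0.
    exact: Ps.
  have [|e e0 es] := @small_multiple _ s (fun v => dot u' (w v)) (dot u).
    by move=> v vs; apply: u's; exact: map_f.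
  (* With [e = 0] this vector would be orthogonal to [m] and pair with [v] to [dot u' (w v) > 0];
     since [dot u m < 0], subtracting a small multiple of [u] makes it positive on [m] too. *)
  exists (- dot u m *: u' + (dot u' m - e) *: u) => v.
  rewrite dotDl !dotZl inE => /orP[/eqP ->|vs].
    rewrite (_ : _ + _ = e * - dot u m); last by ring.
    by rewrite mulr_gt0// oppr_gt0.
  have := es v vs; rewrite /w dotDr !dotZr.
  have := ler_norm (dot u v); rewrite -(ler_pM2l e0).
  lra.
(* Here [u] is orthogonal to [m], so tilting it towards [m] gains [e * dot m m]. *)
- have [e e0 es] := @small_multiple _ s (dot u) (dot m) us.
  exists (u + e *: m) => v; rewrite dotDl dotZl inE => /orP[/eqP ->|vs].
    by rewrite -um add0r mulr_gt0// dot_gt0.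
  have := es v vs.
  have := ler_normlW (lexx `| - dot m v|); rewrite normrN -(ler_pM2l e0).
  lra.
Qed.

End Gordan.

(** * Exposing hull vertices by half-spaces and cones *)

Section HullVertices.
Context {R : realType} {d : nat}.
Implicit Types (X : {fset 'rV[R]_d}) (x y : 'rV[R]_d).

Lemma convex_hull_conv X y z (t : R) : 0 <= t -> t <= 1 ->
  convex_hull [set` X] y -> convex_hull [set` X] z ->
  convex_hull [set` X] (t *: y + (1 - t) *: z).
Proof.
move=> t0 t1 Cy Cz C [cC XC].
have := cC y z (Itv01 t0 t1); rewrite !inE; apply.
  exact: (Cy C (conj cC XC)).
exact: (Cz C (conj cC XC)).
Qed.

Lemma hull_vertex_conv X x y z (t : R) : hull_vertices X x ->
  convex_hull [set` X] y -> convex_hull [set` X] z -> 0 < t -> t < 1 ->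
  x = t *: y + (1 - t) *: z -> y = x /\ z = x.
Proof.
move=> [_ ext] Cy Cz t0 t1 xE.
exact: (ext y z (Itv01 (ltW t0) (ltW t1))).
Qed.

(** Extremality makes the set [P] of directions from [x] to other hull points closed under addition:
    no proper convex combination of such points is [x]. *)
Lemma hull_vertex_exposed X x : hull_vertices X x ->
  exists u, forall y, y \in X -> y != x -> 0 < dot u (y - x).
Proof.
move=> vx.
pose P w := exists t z, [/\ 0 < t, convex_hull [set` X] z, z != x &
  w = t *: (z - x)].
have PD v w : P v -> P w -> P (v + w).
  move=> [t [y [t0 Cy yx ->]]] [t' [z [t'0 Cz zx ->]]].
  (* The weight that turns [t (y - x) + t' (z - x)] into [t + t'] times a single direction. *)
  pose r := t / (t + t').
  have tt : 0 < t + t' by rewrite addr_gt0.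
  have r0 : 0 < r by rewrite divr_gt0.
  have r1 : r < 1 by rewrite ltr_pdivrMr// mul1r ltrDl.
  exists (t + t'), (r *: y + (1 - r) *: z); split => //.
  - by apply: convex_hull_conv => //; exact: ltW.
  - apply/eqP => /esym /(hull_vertex_conv X x y z r vx Cy Cz r0 r1)[yE _].
    by rewrite yE eqxx in yx.
  - apply/rowP => j; rewrite !mxE /r; field.
    by rewrite gt_eqF.
have PZ c v : 0 < c -> P v -> P (c *: v).
  move=> c0 [t [y [t0 Cy yx ->]]].
  by exists (c * t), y; split => //; [rewrite mulr_gt0|rewrite scalerA].
have P0 : ~ P 0.
  move=> [t [y [t0 _ yx /esym/eqP]]].
  by rewrite scaler_eq0 gt_eqF//= subr_eq0; exact/negP.
have [v|u us] := @gordan R d P [seq y - x | y <- X & y != x] PD PZ P0.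
  move=> /mapP[y]; rewrite mem_filter => /andP[yx yX] ->.
  exists 1, y; split => //; last by rewrite scale1r.
  exact: sub_gen_smallest.
exists u => y yX yx; apply: us; apply/mapP; exists y => //.
by rewrite mem_filter yx.
Qed.

(* Y lies weakly on one side of the double cone at x, of l1-slope 1 and with
   axis the j-th coordinate axis; the sign s tells which side. *)
Definition cone_exposed (Y : {fset 'rV[R]_d}) x (j : 'I_d) (s : bool) :=
  forall y, y \in Y ->
    (-1) ^+ s * (x 0 j - y 0 j) <= \sum_(k < d | k != j) `|x 0 k - y 0 k|.

(** Dividing [dot u (y - x) > 0] by the largest [|u_j|] leaves coefficients of absolute value at
    most 1 on the other coordinates; [s] records the sign of [u_j]. *)
Lemma hull_vertex_cone_exposed X x : (0 < d)%N -> hull_vertices X x ->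
  exists j s, cone_exposed X x j s.
Proof.
move=> d0 /hull_vertex_exposed[u us].
have [j _ jmax] := @arg_maxP _ _ _ (Ordinal d0) predT (fun k => `|u 0 k|) isT.
exists j, (u 0 j < 0) => y yX.
have [->|yx] := eqVneq y x.
  by rewrite subrr mulr0 sumr_ge0.
have := us y yX yx; rewrite /dot (bigD1 j)//=.
have lesum : \sum_(i < d | i != j) u 0 i * (y - x) 0 i <=
    `|u 0 j| * \sum_(k < d | k != j) `|x 0 k - y 0 k|.
  rewrite mulr_sumr; apply: ler_sum => k _.
  apply: le_trans (ler_norm _) _; rewrite normrM !mxE distrC.
  by apply: ler_wpM2r => //; exact: jmax.
move: lesum; set S := \sum_(k < d | _) `| _ |; set T := \sum_(k < d | _) _.
move=> TS; rewrite !mxE {1}[u 0 j]numEsign -mulrA mulrCA => uT.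
have uj : 0 < `|u 0 j|.
  rewrite lt_neqAle normr_ge0 andbT; apply/eqP => uj0.
  by move: TS uT; rewrite -uj0 !mul0r add0r => /le_lt_trans h /h; rewrite ltxx.
rewrite -(ler_pM2l uj); apply: le_trans TS.
by move: uT; rewrite -opprB !mulrN mulrCA; lra.
Qed.

Lemma enorm_le_sum x : enorm x <= \sum_(j < d) `|x 0 j|.
Proof.
have S0 : 0 <= \sum_(j < d) `|x 0 j| by exact: sumr_ge0.
rewrite -[leRHS](ger0_norm S0) -sqrtr_sqr ler_wsqrtr// expr2 mulr_suml.
apply: ler_sum => j _; rewrite -real_normK ?num_real// expr2 ler_wpM2l//.
by rewrite (bigD1 j)//= lerDl sumr_ge0.
Qed.

Lemma normr_le_enorm x j : `|x 0 j| <= enorm x.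
Proof.
rewrite -sqrtr_sqr ler_wsqrtr// (bigD1 j)//= lerDl.
by apply: sumr_ge0 => k _; exact: sqr_ge0.
Qed.

(** The two exposure conditions bound the difference of the [j]-th coordinates from both sides, and
    the Euclidean norm is at most the l1 norm. *)
Lemma cone_exposed_enorm_le X x y j s : x \in X -> y \in X ->
  cone_exposed X x j s -> cone_exposed X y j s ->
  enorm (x - y) <= 2 * \sum_(k < d | k != j) `|x 0 k - y 0 k|.
Proof.
move=> xX yX /(_ y yX) ex /(_ x xX) ey.
apply: le_trans (enorm_le_sum _) _; rewrite (bigD1 j)//= !mxE.
under eq_bigr do rewrite !mxE.
have {}ey : (-1) ^+ s * (y 0 j - x 0 j) <=
    \sum_(k < d | k != j) `|x 0 k - y 0 k|.
  by under eq_bigr do rewrite distrC.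
rewrite mulr2n mulrDl !mul1r lerD2r.
rewrite -[leLHS]mul1r -(normr_sign R s) -normrM ler_norml ex andbT.
by move: ey; rewrite -opprB mulrN; lra.
Qed.

End HullVertices.

(** * Grid count for one layer and the bound on the number of layers *)

Section Layers.
Context {R : realType} {d' : nat}.
Local Notation d := d'.+1.
Implicit Types (X Y : {fset 'rV[R]_d}).

Definition separated (delta : R) X :=
  forall x y, x \in X -> y \in X -> x != y -> delta <= enorm (x - y).

(* 1 / M is the mesh of the grid on [-1, 1]^(d-1). *)
Lemma layer_card_le (delta : R) (M : nat) X :
  [set` X] `<=` @unit_ball R d -> separated delta X ->
  2 * d%:R < delta * M%:R ->
  (#|` X| <= d * 2 * (M.*2).+1 ^ d' + #|` peel X|)%N.
Proof.
move=> Xball Xsep dM.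
have M0 : 0 < M%:R :> R.
  rewrite ltr0n lt0n; apply/eqP => M0; move: dM.
  by rewrite M0 mulr0 ltNge mulr_ge0.
rewrite -(cardfsID (peel X) X) addnC leq_add//; last first.
  by apply: fsubset_leq_card; exact: fsubsetIr.
set V := (X `\` _)%fset.
have VX x : x \in V -> x \in X by rewrite inE => /andP[].
have /choice[c cP] (x : 'rV[R]_d) : exists p : 'I_d * bool,
    x \in V -> cone_exposed X x p.1 p.2.
  have [xV|xV] := boolP (x \in V); last first.
    by exists (ord0, true).
  have vx : hull_vertices X x.
    by move: xV; rewrite !inE => /andP[+ xX]; rewrite xX/= negbK => /asboolP.
  have [j [s js]] := @hull_vertex_cone_exposed R d X x isT vx.
  by exists (j, s).
(* [q] maps [-1, 1] to [0, 2M], so truncation takes 2M + 1 values, the last one only at coordinate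
   1. [lift] skips the coordinate of the class. *)
pose q (x : 'rV[R]_d) k : R := (x 0 k + 1) * M%:R.
pose cell x : {ffun 'I_d' -> 'I_(M.*2).+1} :=
  [ffun k => inord (Num.truncn (q x (lift (c x).1 k)))].
have coord x k : x \in V -> 0 <= q x k < (M.*2).+1%:R.
  move=> xV; have := le_trans (normr_le_enorm x k) (Xball x (VX x xV)).
  rewrite ler_norml => /andP[x1 x2]; apply/andP; split.
    by rewrite mulr_ge0//; lra.
  rewrite -addn1 natrD -muln2 natrM /q mulrC.
  rewrite (@le_lt_trans _ _ (M%:R * 2)) ?ltrDl// ler_pM2l//; lra.
(* Points sharing class and cell differ by at most 1/M in each of the [d'] other coordinates, hence
   are at distance at most 2d/M < [delta]. *)
have codeI : injective (fun x : V => (c (val x), cell (val x))).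
  move=> [x xV] [y yV] /= [cxy cellxy]; apply/val_inj => /=.
  apply/eqP/negPn/negP => xy.
  have := Xsep x y (VX x xV) (VX y yV) xy.
  have cy := cP y yV; rewrite -cxy in cy.
  move/le_trans => /(_ _ (cone_exposed_enorm_le X x y _ _ (VX x xV) (VX y yV)
    (cP x xV) cy)).
  rewrite leNgt => /negP; apply.
  rewrite -(ltr_pM2r M0); apply: le_lt_trans dM.
  rewrite -mulrA ler_pM2l// mulr_suml.
  apply: (@le_trans _ _ (\sum_(k < d | k != (c x).1) 1)); last first.
    by rewrite sumr_const ler_nat -[leqRHS]card_ord max_card.
  apply: ler_sum => k; rewrite eq_sym => kj.
  have [i -> _] := unlift_some kj.
  have := congr1 (fun f : {ffun _ -> _} => val (f i)) cellxy.
  rewrite !ffunE /= -cxy; set k' := lift _ i.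
  have /andP[qx0 qx1] := coord x k' xV; have /andP[qy0 qy1] := coord y k' yV.
  rewrite !inordK ?truncn_lt_nat// => qxy.
  have := truncn_itv qx0; have := truncn_itv qy0; rewrite qxy.
  set n := Num.truncn _; rewrite -addn1 natrD => /andP[y1 y2] /andP[x1 x2].
  rewrite -[X in _ * X](ger0_norm (ltW M0)) -normrM ler_norml.
  by move: x1 x2 y1 y2; rewrite /q; lra.
rewrite cardfE; apply: leq_trans (leq_card _ codeI) _.
by rewrite !card_prod card_ffun !card_ord card_bool.
Qed.

Lemma peel_sub X : (peel X `<=` X)%fset.
Proof. by apply/fsubsetP => x; rewrite !inE => /andP[]. Qed.

(** Both hypotheses on [X] pass to subsets, so the same bound serves every layer. *)
Lemma card_le_layer_number (delta : R) (M : nat) X :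
  [set` X] `<=` @unit_ball R d -> separated delta X ->
  2 * d%:R < delta * M%:R ->
  (#|` X| <= layer_number X * (d * 2 * (M.*2).+1 ^ d'))%N.
Proof.
move=> Xball Xsep dM; set B := (_ * _ ^ _)%N.
have iterS k : (iter k (@peel R d) X `<=` X)%fset.
  elim: k => [|k IH]; first exact: fsubset_refl.
  by apply: fsubset_trans IH; exact: peel_sub.
have leB k : (#|` X| <= k * B + #|` iter k (@peel R d) X|)%N.
  elim: k => [|k IH]; first by rewrite mul0n.
  apply: leq_trans IH _; rewrite mulSn [(B + _)%N]addnC -addnA leq_add2l.
  have sub := fsubsetP (iterS k).
  apply: (@layer_card_le delta) dM => [x /sub /Xball//|x y /sub xX /sub yX].
  exact: Xsep.
rewrite /layer_number; case: ex_minnP => L /eqP L0 _.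
by have := leB L; rewrite L0 cardfs0 addn0.
Qed.

Lemma min_dist_separated X : separated (min_dist X) X.
Proof.
move=> x y xX yX xy; apply: ge_inf; last by exists x, y.
by exists 0 => _ [? [? [_ _ _ ->]]]; exact: sqrtr_ge0.
Qed.

(** With [t = n^(1/d)] and a mesh of order [1/t], a layer takes [O(t^(d-1))] of the [t^d] points. *)
Lemma layer_number_ge (a : R) X : 0 < a ->
  [set` X] `<=` @unit_ball R d ->
  a * #|` X|%:R `^ (- d%:R^-1) <= min_dist X ->
  (2 * d%:R * ((4 * d%:R + 3 * a) / a) ^+ d')^-1 * #|` X|%:R `^ (d%:R^-1)
    <= (layer_number X)%:R.
Proof.
move=> a0 Xball; have [->|] := posnP #|` X|.
  by move=> _; rewrite powR0 ?invr_neq0 ?pnatr_eq0// mulr0.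
set n := #|` X| => n0; set t := n%:R `^ d%:R^-1; rewrite powRN -/t => mind.
have t1 : 1 <= t.
  by rewrite -(powRr0 n%:R) ler_powR ?invr_ge0// ler1n.
have t0 : 0 < t by exact: lt_le_trans t1.
have tn : t ^+ d = n%:R.
  by rewrite -powR_mulrn ?ltW// -powRrM mulVf ?pnatr_eq0// powRr1.
pose delta := a / t; pose M := (Num.truncn (2 * d%:R / delta)).+1.
have delta0 : 0 < delta by rewrite divr_gt0.
have dM0 : 0 <= 2 * d%:R / delta.
  by apply: divr_ge0 (ltW delta0); rewrite mulr_ge0.
have /andP[Mle Mgt] := truncn_itv dM0; rewrite -/M in Mgt.
have dM : 2 * d%:R < delta * M%:R by rewrite [ltRHS]mulrC -ltr_pdivrMr.
have Xsep : separated delta X.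
  by move=> x y xX yX xy; apply: le_trans mind _; exact: min_dist_separated.
have := @card_le_layer_number delta M X Xball Xsep dM.
rewrite -/n -(ler_nat R) !natrM natrX -tn => nL.
have D0 : 0 < 4 * d%:R + 3 * a by rewrite addr_gt0// mulr_gt0.
(* 2M + 1 is at most 4d/[delta] + 3, and [t >= 1] absorbs the 3 into 3t. *)
have MN : (M.*2).+1%:R <= (4 * d%:R + 3 * a) / a * t.
  have e : (4 * d%:R + 3 * a) / a * t = 2 * (2 * d%:R / delta) + 3 * t.
    by rewrite /delta; field; rewrite !gt_eqF.
  rewrite e -addn1 natrD -muln2 natrM /M -addn1 natrD.
  by move: Mle t1; lra.
rewrite mulrC ler_pdivrMr; last by rewrite !mulr_gt0// exprn_gt0// divr_gt0.
(* Multiplying by [t^(d-1)] turns the left side into [t^d = n]. *)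
rewrite -(ler_pM2r (exprn_gt0 d' t0)) -exprS; apply: le_trans nL _.
rewrite -!mulrA ler_wpM2l// [d%:R * _]mulrCA !ler_wpM2l// -exprMn.
by rewrite lerXn2r ?nnegrE// mulr_ge0 ?divr_ge0// ltW.
Qed.

End Layers.

Theorem theorem1p4 (R : realType) (d : nat) (hd : (1 <= d)%N)
    (a b : R) (ha : 0 < a) (hb : 0 < b) :
  exists2 c : R, 0 < c &
    forall X : nat -> {fset 'rV[R]_d}, evenly_distributed a b X ->
      \forall i \near \oo,
        c * #|` X i|%:R `^ (d%:R^-1) <= (layer_number (X i))%:R.
Proof.
case: d hd => // d' _.
exists ((2 * d'.+1%:R * ((4 * d'.+1%:R + 3 * a) / a) ^+ d')^-1).
  by rewrite invr_gt0 !mulr_gt0// exprn_gt0// divr_gt0// addr_gt0// mulr_gt0.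
move=> X [Xball _ Xdist]; near=> i.
apply: layer_number_ge => //.
by have [] : a * #|` X i|%:R `^ (- d'.+1%:R^-1) <= min_dist (X i) /\
  min_dist (X i) <= b * #|` X i|%:R `^ (- d'.+1%:R^-1) by near: i.
Unshelve. all: by end_near. Qed.
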